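(* Let $C\subset\mathbb R$ be a compact interval, let $\mathcal T\subset\mathbb N$ be a finite Sharkovskiĭ tail with first element $n$, and let $f\colon C\to C$ be a continuous map with $f\in\mathcal H_{\mathcal T}$ which, for every $k\in\mathcal T$, has at least one periodic orbit of minimal period $k$. Then there exist, for each $k\in\mathcal T$, a periodic orbit $S_k=\{p_{k,1},\dots,p_{k,k}\}\subset\operatorname{int}C$ of $f$ of minimal period $k$, pairwise disjoint closed intervals $N_{k,j}\subset\operatorname{int}C$ with $p_{k,j}\in\operatorname{int}N_{k,j}$, and numbers $\epsilon>0$, $\delta>0$, such that for every invertible, measure-preserving, ergodic $\theta$ on a probability space $(\Omega,\mathcal F,\mathbb P)$ and every random map $\varphi\in\mathcal R^1_\epsilon(f)$ (defined with respect to these intervals), the RDS $\phi$ generated by $\varphi$ over $\theta$ satisfies: (1) for every $k\in\mathcal T$, $\phi$ admits a random periodic point of minimal random period $k$; (2) if moreover $\theta^k$ is ergodic for every $k\in\mathbb N$, then for every $k\in\mathcal T$, $\phi$ admits a random periodic orbit of minimal period $k$; (3) for every $k\in\mathcal T$, $\phi$ admits a $(\delta,k)$-random periodic point (hence a $(\delta,k)$-random periodic orbit).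
   Context: Sharkovskiĭ ordering $\prec$ on $\mathbb N$: $3\prec5\prec7\prec\cdots\prec2\cdot3\prec2\cdot5\prec\cdots\prec2^2\cdot3\prec2^2\cdot5\prec\cdots\prec2^3\prec2^2\prec2\prec1$. For $n\in\mathbb N$, $\mathcal T(n)=\{m\in\mathbb N: m=n\text{ or }n\prec m\}$. A finite Sharkovskiĭ tail is a nonempty finite set $\mathcal T=\{k_1,\dots,k_m\}$ with $n=k_1\prec k_2\prec\cdots\prec k_m$ consecutive in the ordering starting at $n$ (i.e. $\mathcal T\subset\mathcal T(n)$, $n\in\mathcal T$, and if $n\prec k\prec\ell$ with $\ell\in\mathcal T$ then $k\in\mathcal T$); $n$ is called its first element. A periodic orbit $\{p_0,\dots,p_{k-1}\}\subset\operatorname{int}C$ of minimal period $k$ is hyperbolic if $f$ is $C^1$ on a neighbourhood of the orbit and $|(f^k)'(p_j)|\neq1$ for all $j$. $\mathcal H_{\mathcal T}$ is the set of continuous $f\colon C\to C$ such that for every $k\in\mathcal T$ every periodic orbit of minimal period $k$ is hyperbolic and contained in $\operatorname{int}C$. Given the intervals $N_{k,j}$ and $N=\bigcup_{k\in\mathcal T}\bigcup_{j=1}^kN_{k,j}$, $\mathcal R^1_\epsilon(f)$ is the class of maps $\varphi\colon\Omega\times C\to C$, $(\mathcal F\otimes\mathcal B(C))$-measurable, such that: each $\varphi(\omega,\cdot)$ is continuous on $C$ and piecewise $C^1$ with all breakpoints in $C\setminus N$; $\sup_{\omega}\sup_{x\in N}\bigl(|\varphi(\omega,x)-f(x)|+|\partial_x\varphi(\omega,x)-f'(x)|\bigr)<\epsilon$;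 and $\sup_\omega\sup_{x\in C}|\varphi(\omega,x)-f(x)|<\epsilon$. The RDS generated by $\varphi$ over $\theta$ is $\phi(0,\omega,x)=x$, $\phi(n,\omega,x)=\varphi(\theta^{n-1}\omega,\cdot)\circ\cdots\circ\varphi(\omega,\cdot)(x)$ for $n\ge1$. A measurable $x\colon\Omega\to C$ is a random periodic point of period $k$ if $\phi(k,\omega,x(\omega))=x(\theta^k\omega)$ for $\mathbb P$-a.e. $\omega$; it has minimal random period $k$ if additionally $\mathbb P(\phi(l,\omega,x(\omega))\neq x(\theta^l\omega))>0$ for every $l\in\{1,\dots,k-1\}$. A random set $P\colon\Omega\to\mathcal P(C)$ is random invariant if $\varphi(\omega,P(\omega))=P(\theta\omega)$ a.s.; a random invariant set $P$ is a random periodic orbit of period $k$ if $\#P(\omega)=k$ a.s., and has minimal period $k$ if it contains no nonempty proper random invariant subset. For measurable $x\colon\Omega\to C$, $k\in\mathbb N$ and $\ell\in\{0,\dots,k-1\}$ let $S_\ell(\omega)=\{\phi(mk+\ell,\omega,x(\omega)):m\in\mathbb N_0\}$; $x$ is a $(\delta,k)$-random periodic point if for a.e. $\omega$: $\operatorname{diam}S_\ell(\omega)<\delta$ for all $\ell$, and $\operatorname{dist}(S_i(\omega),S_j(\omega))>\delta$ for $i\neq j$; the family $\{S_\ell(\omega)\}_{\ell=0}^{k-1}$ is then called a $(\delta,k)$-random periodic orbit. *)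

(* Defs.v *)
From mathcomp Require Import all_boot all_order all_algebra.
From mathcomp Require Import all_classical all_reals all_analysis.
Import Order.TTheory GRing.Theory Num.Theory.
Import numFieldNormedType.Exports.

Set Implicit Arguments.
Unset Strict Implicit.
Unset Printing Implicit Defensive.

Definition odd_part (m : nat) : nat := (m %/ 2 ^ logn 2 m)%N.
Definition is_pow2 (m : nat) : bool := odd_part m == 1%N.

(* shark_lt m m' means  m ≺ m'  in the Sharkovskii ordering
   3 ≺ 5 ≺ 7 ≺ ... ≺ 2·3 ≺ 2·5 ≺ ... ≺ 2^2·3 ≺ ... ≺ 2^3 ≺ 2^2 ≺ 2 ≺ 1 *)
Definition shark_lt (m m' : nat) : bool :=
  match is_pow2 m, is_pow2 m' with
  | false, false => (logn 2 m < logn 2 m')%N ||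
                    ((logn 2 m == logn 2 m') && (odd_part m < odd_part m')%N)
  | false, true => true
  | true, false => false
  | true, true => (logn 2 m' < logn 2 m)%N
  end.

Definition shark_tail (n : nat) : pred nat :=
  fun m => (0 < m)%N && ((m == n) || shark_lt n m).

Definition finite_shark_tail (T : seq nat) (n : nat) : Prop :=
  [/\ (0 < n)%N, n \in T, {subset T <= shark_tail n} &
      forall k l : nat, (0 < k)%N -> shark_lt n k -> shark_lt k l -> l \in T -> k \in T].

Local Open Scope classical_set_scope.
Local Open Scope ring_scope.

Section RealDefs.
Variable R : realType.

Definition periodic_pt_min (f : R -> R) (k : nat) (p : R) : Prop :=
  [/\ (0 < k)%N, iter k f p = p & forall j, (0 < j < k)%N -> iter j f p != p].

Definition hyperbolic_int_orbit (a b : R) (f : R -> R) (k : nat) (p : R) : Prop :=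
  [/\ (forall j, (j < k)%N -> a < iter j f p < b),
      (exists e : R, 0 < e /\ forall j, (j < k)%N -> forall y,
          `|y - iter j f p| < e -> derivable f y 1 /\ {for y, continuous (@derive1 R R f)})
    & forall j, (j < k)%N -> `|@derive1 R R (iter k f) (iter j f p)| != 1].

Definition H_T (a b : R) (T : seq nat) (f : R -> R) : Prop :=
  forall k, k \in T -> forall p, a <= p <= b -> periodic_pt_min f k p ->
    hyperbolic_int_orbit a b f k p.

Definition C1_on (g : R -> R) (u v : R) : Prop :=
  [/\ u < v, {within `[u, v], continuous g} &
      exists dg : R -> R, {within `[u, v], continuous dg} /\
        forall x, u < x < v -> derivable g x 1 /\ @derive1 R R g x = dg x].

Definition piecewise_C1 (a b : R) (N : set R) (g : R -> R) : Prop :=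
  exists s : seq R,
    [/\ sorted <%R (a :: rcons s b), (forall t, t \in s -> ~ N t) &
        forall i, (i < (size s).+1)%N -> C1_on g (nth 0 (a :: s) i) (nth 0 (rcons s b) i)].

Definition Nunion (T : seq nat) (l r : nat -> nat -> R) : set R :=
  [set x | exists k j, [/\ k \in T, (j < k)%N & l k j <= x <= r k j]].

Section Random.
Context {d : measure_display} {Om : measurableType d}.
Variable P : probability Om R.

Definition measure_preserving (theta : Om -> Om) : Prop :=
  measurable_fun setT theta /\
  forall A, measurable A -> P (theta @^-1` A) = P A.

Definition invertible_measure_preserving (theta : Om -> Om) : Prop :=
  measure_preserving theta /\
  exists thinv : Om -> Om,
    [/\ measurable_fun setT thinv, cancel theta thinv & cancel thinv theta].

Definition ergodic (theta : Om -> Om) : Prop :=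
  forall A, measurable A -> theta @^-1` A = A -> P A = 0%E \/ P A = 1%E.

Fixpoint rds (theta : Om -> Om) (phi : Om -> R -> R) (n : nat) (w : Om) (x : R) : R :=
  match n with
  | 0 => x
  | n'.+1 => phi (iter n' theta w) (rds theta phi n' w x)
  end.

Definition R1eps (a b : R) (N : set R) (f : R -> R) (eps : R) (phi : Om -> R -> R) : Prop :=
  [/\ measurable_fun (setT `*` `[a, b]) (fun z : Om * R => phi z.1 z.2),
      (forall w x, a <= x <= b -> a <= phi w x <= b),
      (forall w, {within `[a, b], continuous phi w} /\ piecewise_C1 a b N (phi w)),
      (exists eta, eta < eps /\ forall w x, N x ->
          `|phi w x - f x| + `|@derive1 R R (phi w) x - @derive1 R R f x| <= eta)
    & (exists eta, eta < eps /\ forall w x, a <= x <= b -> `|phi w x - f x| <= eta)].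

Definition random_point_in (a b : R) (x : Om -> R) : Prop :=
  measurable_fun setT x /\ forall w, a <= x w <= b.

Definition random_periodic_point (theta : Om -> Om) (phi : Om -> R -> R)
    (a b : R) (x : Om -> R) (k : nat) : Prop :=
  random_point_in a b x /\
  {ae P, forall w, rds theta phi k w (x w) = x (iter k theta w)}.

Definition random_periodic_point_min (theta : Om -> Om) (phi : Om -> R -> R)
    (a b : R) (x : Om -> R) (k : nat) : Prop :=
  random_periodic_point theta phi a b x k /\
  forall l, (0 < l < k)%N ->
    (0 < P [set w | rds theta phi l w (x w) != x (iter l theta w)])%E.

(* random (closed) set with values in C: Effros-measurable *)
Definition random_set (a b : R) (S : Om -> set R) : Prop :=
  (forall w, S w `<=` `[a, b]) /\
  forall U : set R, open U -> measurable [set w | S w `&` U !=set0].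

Definition random_invariant (theta : Om -> Om) (phi : Om -> R -> R) (S : Om -> set R) : Prop :=
  {ae P, forall w, phi w @` S w = S (theta w)}.

Definition has_card (k : nat) (A : set R) : Prop :=
  exists s : seq R, [/\ uniq s, size s = k & A = [set x | x \in s]].

Definition random_periodic_orbit (theta : Om -> Om) (phi : Om -> R -> R)
    (a b : R) (S : Om -> set R) (k : nat) : Prop :=
  [/\ random_set a b S, random_invariant theta phi S &
      {ae P, forall w, has_card k (S w)}].

Definition random_periodic_orbit_min (theta : Om -> Om) (phi : Om -> R -> R)
    (a b : R) (S : Om -> set R) (k : nat) : Prop :=
  random_periodic_orbit theta phi a b S k /\
  forall Q : Om -> set R, random_set a b Q -> random_invariant theta phi Q ->
    {ae P, forall w, Q w `<=` S w} -> {ae P, forall w, Q w !=set0} ->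
    {ae P, forall w, Q w = S w}.

Definition diam (A : set R) : R := sup [set `|u - v| | u in A & v in A].
Definition dist_sets (A B : set R) : R := inf [set `|u - v| | u in A & v in B].

Definition S_ell (theta : Om -> Om) (phi : Om -> R -> R) (x : Om -> R)
    (k l : nat) (w : Om) : set R :=
  range (fun m : nat => rds theta phi (m * k + l)%N w (x w)).

Definition delta_k_random_periodic_point (theta : Om -> Om) (phi : Om -> R -> R)
    (a b : R) (x : Om -> R) (delta : R) (k : nat) : Prop :=
  random_point_in a b x /\
  {ae P, forall w,
     (forall l, (l < k)%N -> diam (S_ell theta phi x k l w) < delta) /\
     (forall i j, (i < k)%N -> (j < k)%N -> i != j ->
        delta < dist_sets (S_ell theta phi x k i w) (S_ell theta phi x k j w))}.

End Random.
End RealDefs.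

(* Main.v *)
Require Import Defs.
From mathcomp Require Import all_boot all_order all_algebra.
From mathcomp Require Import all_classical all_reals all_analysis.
From mathcomp Require Import measurable_realfun ring lra zify.
Import Order.TTheory GRing.Theory Num.Theory.
Import numFieldNormedType.Exports.

Set Implicit Arguments.
Unset Strict Implicit.
Unset Printing Implicit Defensive.

Local Open Scope classical_set_scope.
Local Open Scope ring_scope.

(** Fix a hyperbolic orbit p_0, ..., p_{k-1} with multipliers al_j = f'(p_j).
    Near p_j every admissible random map differs from an affine map of slope
    al_j by a map with small Lipschitz constant (mean value theorem).  Since
    |al_0 ... al_{k-1}| <> 1, weights w_j can be chosen for which each single
    step is a uniform contraction or a uniform expansion.  A family of functions
    x_j : Om -> N_j with phi_w (x_j w) = x_{j+1} (theta w), indices mod k, is then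
    the fixed point of a contraction on 'I_k * Om -> R for the weighted sup norm,
    and it is measurable as a pointwise limit of measurable iterates.  The three
    conclusions follow because the x_j take values in the disjoint N_j: x_0 is
    the random periodic point, and {x_0, ..., x_{k-1}} the random periodic orbit.
    For minimality, given an invariant Q inside this orbit, the event that x_0
    lies in Q is theta^k-invariant, hence trivial. *)

(** * Finite minima and a weighted contraction principle *)

Lemma seq_pos_lower_bound (R : realType) (I : eqType) (s : seq I) (F : I -> R) :
  (forall i, i \in s -> 0 < F i) ->
  exists2 m, 0 < m & forall i, i \in s -> m <= F i.
Proof.
elim: s => [|i s IHs] Fpos; first by exists 1.
have [j js|m m_gt0 mF] := IHs; first by apply: Fpos; rewrite inE js orbT.
exists (Num.min (F i) m).
  by rewrite lt_min m_gt0 Fpos ?inE ?eqxx.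
move=> j; rewrite inE => /orP[/eqP ->|js]; rewrite ge_min ?lexx//.
by rewrite mF// orbT.
Qed.

(** Banach's theorem on the unit ball around [p] for the norm sup |x z| / [W z], stated without
    dividing by [W]. The bound on [T p] keeps the iterates in the ball, where [T] is known to
    contract; the limit is recorded pointwise so that measurability can pass to it. *)
Lemma weighted_fixpoint (R : realType) (Z : Type) (W p : Z -> R)
    (T : (Z -> R) -> Z -> R) (mu : R) :
  0 <= mu < 1 -> (forall z, 0 <= W z) ->
  (forall (x y : Z -> R) D, 0 <= D ->
     (forall z, `|x z - p z| <= W z) -> (forall z, `|y z - p z| <= W z) ->
     (forall z, `|x z - y z| <= D * W z) ->
     forall z, `|T x z - T y z| <= mu * D * W z) ->
  (forall z, `|T p z - p z| <= (1 - mu) * W z) ->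
  exists x : Z -> R,
    [/\ forall z, `|x z - p z| <= W z, forall z, T x z = x z,
        forall n z, `|iter n T p z - p z| <= W z &
        forall z, iter n T p z @[n --> \oo] --> x z].
Proof.
move=> /andP[mu0 mu1] W0 Tcontr Tp.
have ball_iter n z : `|iter n T p z - p z| <= W z.
  elim: n z => [|n IHn] z; first by rewrite /= subrr normr0.
  (* The previous iterate is within [W] of [p], so [D] = 1 applies, and mu + (1 - mu) = 1 keeps the
     next iterate in the ball. *)
  have h : `|T (iter n T p) z - T p z| <= mu * 1 * W z.
    apply: Tcontr => // z'; first by rewrite subrr normr0.
    by rewrite mul1r.
  have := ler_normD (T (iter n T p) z - T p z) (T p z - p z).
  rewrite subrKA iterS => /le_trans; apply.
  by have := Tp z; move: h; lra.
have iter_dist n m z : `|iter (n + m) T p z - iter n T p z| <= mu ^+ n * W z.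
  elim: n z => [|n IHn] z; first by rewrite add0n /= expr0 mul1r.
  rewrite addSn !iterS exprS; apply: Tcontr => //; exact: exprn_ge0.
have geo z (e : R) : 0 < e -> exists n, mu ^+ n * W z < e.
  move=> e0; have /cvgr0_norm_lt/(_ _ e0)[N _ hN] : geometric (W z) mu n @[n --> \oo] --> 0.
    by apply: cvg_geometric; rewrite ger0_norm.
  exists N; have := hN N (leqnn N); rewrite /= mulrC; exact: le_lt_trans (ler_norm _).
have iter_cvg z : cvg (iter n T p z @[n --> \oo]).
  apply/cauchy_cvgP/cauchy_exP => e e0; have [N hN] := geo z e e0.
  exists (iter N T p z); exists N => // m /= Nm.
  rewrite /ball /= distrC -(subnKC Nm); exact: le_lt_trans (iter_dist _ _ _) hN.
pose x z := lim (iter n T p z @[n --> \oo]).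
have x_iter n z : `|x z - iter n T p z| <= mu ^+ n * W z.
  have h : `|iter m T p z - iter n T p z| @[m --> \oo] --> `|x z - iter n T p z|.
    by apply: cvg_norm; apply: cvgB; [exact: iter_cvg|exact: cvg_cst].
  by apply: (cvgr_to_le h); exists n => // m /= nm; rewrite -(subnKC nm).
have x_ball z : `|x z - p z| <= W z by have := x_iter 0%N z; rewrite /= expr0 mul1r.
exists x; split=> // z; apply/eqP; rewrite -subr_eq0 -normr_le0.
(* |T x - x| is at most |T x - T x_N| + |x_(N+1) - x|; both terms are bounded by mu^(N+1) [W], hence
   below e/2 for a suitable N. *)
apply/ler_addgt0Pl => e e0; rewrite addr0.
have [N hN] := geo z _ (divr_gt0 e0 (ltr0n _ 2)).
have h1 : `|T x z - T (iter N T p) z| <= mu * mu ^+ N * W z.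
  by apply: Tcontr => //; exact: exprn_ge0.
have h2 : mu * (mu ^+ N * W z) <= mu ^+ N * W z.
  by apply: ler_piMl; rewrite ?mulr_ge0 ?exprn_ge0// ltW.
have := x_iter N.+1 z; rewrite iterS exprS distrC => h3.
have := ler_normD (T x z - T (iter N T p) z) (T (iter N T p) z - x z).
rewrite subrKA => /le_trans; apply; move: h1 h2 h3 hN; lra.
Qed.

(** * Weights around a cycle of multipliers *)

(** Taking w_j as the product of the g_i with i < j gives equality at every step except the one that
    wraps around, where w_0 = 1 bounds the full product. *)
Lemma cyclic_weights (R : realType) k (g : 'I_k -> R) :
  (forall i, 0 < g i) -> \prod_i g i <= 1 ->
  exists w : 'I_k -> R, (forall j, 0 < w j) /\ forall j, g j * w j <= w (ordS j).
Proof.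
move=> g0 g1; exists (fun j => \prod_(i < k | (i < j)%N) g i); split=> j.
  by apply: prodr_gt0.
have -> : g j * \prod_(i < k | (i < j)%N) g i = \prod_(i < k | (i < j.+1)%N) g i.
  rewrite [RHS](bigD1 j)//=; congr (_ * _); apply: eq_bigl => i.
  by rewrite ltnS [RHS]andbC -ltn_neqAle.
case: (ltnP j.+1 k) => [jk|kj] /=; first by rewrite modn_small.
have ->: j.+1 = k by apply/eqP; rewrite eqn_leq kj ltn_ord.
rewrite modnn [leRHS]big_pred0 ?(eq_bigl predT) // => i.
exact: ltn_ord.
Qed.

Lemma cvg_prod_at_right0 (R : realType) k (G : 'I_k -> R -> R) (l : 'I_k -> R) :
  (forall j, G j t @[t --> 0] --> l j) ->
  \prod_j G j t @[t --> 0^'+] --> \prod_j l j.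
Proof.
move=> Gl; apply: cvg_at_right_filter; apply: cvg_big => //.
exact: mul_continuous.
Qed.

(** A slack t > 0 is spent twice: added to |al_j| it becomes [eta], and the factor 1 + t becomes the
    rate [mu] = 1 / (1 + t). As t tends to 0 the product of the enlarged factors tends to |prod
    al_j| < 1, so some t is affordable. *)
Lemma contracting_weights (R : realType) k (al : 'I_k -> R) :
  `|\prod_j al j| < 1 ->
  exists (eta mu : R) (w : 'I_k -> R),
    [/\ 0 < eta, 0 < mu < 1, forall j, 0 < w j &
        forall j, (`|al j| + eta) * w j <= mu * w (ordS j)].
Proof.
rewrite normr_prod => al1.
have hG : \prod_j ((`|al j| + t) * (1 + t)) @[t --> (0:R)^'+] --> \prod_j `|al j|.
  apply: cvg_prod_at_right0 => j; 
  suff : (`|al j| + t) * (1 + t) @[t --> (0:R)] --> (`|al j| + 0) * (1 + 0).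
    by rewrite !addr0 mulr1.
  by apply: cvgM; apply: cvgD; (exact: cvg_cst || exact: cvg_id).
have [t [t0 ht]] : exists t : R, 0 < t /\ \prod_j ((`|al j| + t) * (1 + t)) < 1.
  near (0:R)^'+ => t; exists t; split; near: t; first exact: nbhs_right_gt.
  exact: cvgr_lt al1.
have a0 j : 0 < `|al j| + t by have := normr_ge0 (al j); lra.
have [|w [w0 hw]] := @cyclic_weights R k _ _ (ltW ht).
  by move=> i; rewrite mulr_gt0//; lra.
exists t, (1 + t)^-1, w; split => //.
  by rewrite invr_gt0 invf_lt1; lra.
move=> j; rewrite ler_pdivlMl; last by lra.
by rewrite mulrA [(1 + t) * _]mulrC.
Unshelve. all: by end_near. Qed.

(** Cyclic weights for the factors 1 / (|al_j| (1 - t) - t) are inverted, which turns their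
    inequality into w_(j+1) <= (|al_j| (1 - t) - t) w_j; here [mu] = 1 - t and [eta] = t. *)
Lemma expanding_weights (R : realType) k (al : 'I_k -> R) :
  1 < `|\prod_j al j| ->
  exists (eta mu : R) (w : 'I_k -> R),
    [/\ 0 < eta, 0 < mu < 1, forall j, 0 < w j, forall j, al j != 0 &
        forall j, eta * w j + w (ordS j) <= mu * `|al j| * w j].
Proof.
move=> al1.
have al0 j : al j != 0.
  apply/eqP => aj; move: al1; rewrite (bigD1 j)//= aj mul0r normr0; lra.
rewrite normr_prod in al1.
have hGj j : `|al j| * (1 - t) - t @[t --> (0:R)] --> `|al j|.
  suff : `|al j| * (1 - t) - t @[t --> (0:R)] --> `|al j| * (1 - 0) - 0.
    by rewrite !subr0 mulr1.
  apply: cvgB => //; apply: cvgM; first exact: cvg_cst.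
  by apply: cvgB => //; exact: cvg_cst.
have hG : \prod_j (`|al j| * (1 - t) - t) @[t --> (0:R)^'+] --> \prod_j `|al j|.
  exact: cvg_prod_at_right0.
have [t [t0 t1 ht htj]] : exists t : R, [/\ 0 < t, t < 1,
    1 < \prod_j (`|al j| * (1 - t) - t) & forall j, 0 < `|al j| * (1 - t) - t].
  near (0:R)^'+ => t; exists t; split; near: t; first exact: nbhs_right_gt.
  - exact: nbhs_right_lt.
  - exact: cvgr_gt al1.
  - apply: filter_forall => j; apply: (cvgr_gt _ (cvg_at_right_filter (hGj j))).
    by rewrite normr_gt0.
have [||v [v0 hv]] := @cyclic_weights R k (fun j => (`|al j| * (1 - t) - t)^-1).
- by move=> i; rewrite invr_gt0.
- by rewrite prodfV invf_le1 ?ltW// (lt_trans _ ht).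
exists t, (1 - t), (fun j => (v j)^-1); split => //.
- by apply/andP; split; lra.
- by move=> j; rewrite invr_gt0.
move=> j; rewrite addrC -lerBrDr -mulrBl.
have := hv j; rewrite ler_pdivrMl// => h.
rewrite [(1 - t) * _]mulrC -lef_pV2 ?posrE ?mulr_gt0 ?invr_gt0// invfM !invrK.
by rewrite ler_pdivrMl.
Unshelve. all: by end_near. Qed.

(** * Invariant sections as measurable fixed points *)

Lemma measurable_random_eval (R : realType) d (Om : measurableType d) (a b : R)
    (phi : Om -> R -> R) (x : Om -> R) :
  measurable_fun (setT `*` `[a, b]) (fun z : Om * R => phi z.1 z.2) ->
  measurable_fun setT x -> (forall w, a <= x w <= b) ->
  measurable_fun setT (fun w => phi w (x w)).
Proof.
move=> mphi mx xab.
apply: (@measurable_comp _ _ _ _ _ _ (setT `*` `[a, b]) (fun z : Om * R => phi z.1 z.2)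
  setT (fun w => (w, x w))) => //.
- by apply: measurableX => //; exact: measurable_itv.
- by move=> _ [w _ <-]; split => //=; rewrite in_itv/= xab.
- by apply: measurable_fun_pair => //; exact: measurable_id.
Qed.

(** Stands in for C^1 closeness to slope [al]: the contraction estimates see derivatives only
    through this Lipschitz bound. *)
Definition quasi_linear_on (R : realType) (g : R -> R) (c rho al eta : R) : Prop :=
  forall x y, `|x - c| <= rho -> `|y - c| <= rho ->
    `|g x - g y - al * (x - y)| <= eta * `|x - y|.

(** The equation is imposed at every [w], with no exceptional null set, so the construction involves
    no probability. *)
Definition has_invariant_section (R : realType) k (p rho : 'I_k -> R)
    d (Om : measurableType d) (theta : Om -> Om) (phi : Om -> R -> R) : Prop :=
  exists x : 'I_k -> Om -> R,
    [/\ forall j, measurable_fun setT (x j),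
        forall j w, `|x j w - p j| <= rho j &
        forall j w, phi w (x j w) = x (ordS j) (theta w)].

(** The iterates of [T] from the constant centres are measurable and converge pointwise, so the
    limit is measurable. They stay in [a, b], the range on which [phi] is known to be jointly
    measurable. *)
Lemma fixpoint_section (R : realType) (a b : R) k (p rho : 'I_k -> R) (mu : R)
    d (Om : measurableType d) (T : ('I_k * Om -> R) -> 'I_k * Om -> R) :
  0 < mu < 1 -> (forall j, 0 < rho j) ->
  (forall j, a <= p j - rho j /\ p j + rho j <= b) ->
  (forall (x y : 'I_k * Om -> R) D, 0 <= D ->
     (forall z, `|x z - p z.1| <= rho z.1) -> (forall z, `|y z - p z.1| <= rho z.1) ->
     (forall z, `|x z - y z| <= D * rho z.1) ->
     forall z, `|T x z - T y z| <= mu * D * rho z.1) ->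
  (forall z, `|T (fun z => p z.1) z - p z.1| <= (1 - mu) * rho z.1) ->
  (forall x : 'I_k * Om -> R,
     (forall j, measurable_fun setT (fun w => x (j, w))) ->
     (forall z, a <= x z <= b) ->
     forall j, measurable_fun setT (fun w => T x (j, w))) ->
  exists x : 'I_k * Om -> R,
    [/\ forall j, measurable_fun setT (fun w => x (j, w)),
        forall z, `|x z - p z.1| <= rho z.1 & forall z, T x z = x z].
Proof.
move=> /andP[mu0 mu1] rho0 pab Tcontr Tp mT.
have [||x [xball xfix iball xcvg]] :=
  @weighted_fixpoint R ('I_k * Om)%type (fun z => rho z.1) (fun z => p z.1) T mu _ _ Tcontr Tp.
- by rewrite (ltW mu0).
- by move=> z; rewrite ltW.
exists x; split=> // j.
apply: (@measurable_fun_cvg _ _ _ _ (fun n w => iter n T (fun z => p z.1) (j, w))).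
  move=> n; elim: n j => [|n IHn] j; first by rewrite /=; exact: measurable_cst.
  apply: mT => // z.
  have := iball n z; rewrite ler_distl => /andP[h1 h2]; have [h3 h4] := pab z.1.
  by rewrite (le_trans h3 h1) (le_trans h2 h4).
by move=> w _; exact: xcvg.
Qed.

(** The constants depend on the multipliers alone and the scale [s] stays free, so the radii s w_j
    can be shrunk later. A displacement of the centres by at most c s is what the self-map condition
    tolerates. *)
Lemma hyperbolic_section (R : realType) k (p al : 'I_k -> R) :
  `|\prod_j al j| != 1 ->
  exists (eta c : R) (w : 'I_k -> R),
    [/\ 0 < eta, 0 < c, forall j, 0 < w j &
    forall (s a b : R), 0 < s ->
      (forall j, a <= p j - s * w j /\ p j + s * w j <= b) ->
      forall d (Om : measurableType d) (theta thinv : Om -> Om) (phi : Om -> R -> R),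
        measurable_fun setT theta -> measurable_fun setT thinv ->
        cancel theta thinv -> cancel thinv theta ->
        measurable_fun (setT `*` `[a, b]) (fun z : Om * R => phi z.1 z.2) ->
        (forall om j, quasi_linear_on (phi om) (p j) (s * w j) (al j) eta) ->
        (forall om j, `|phi om (p j) - p (ordS j)| <= c * s) ->
        has_invariant_section p (fun j => s * w j) theta phi].
Proof.
rewrite neq_lt => /orP[al1|al1].
  have [eta [mu [w [eta0 mu01 w0 hw]]]] := contracting_weights al1.
  have [m m0 hm] := seq_pos_lower_bound (s := enum 'I_k) (F := w) (fun j _ => w0 j).
  exists eta, ((1 - mu) * m), w; split => //; first by rewrite mulr_gt0// subr_gt0; case/andP: mu01.
  move=> s a b s0 pab d Om theta thinv phi mth mthi thK thiK mphi ql phip.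
  (* Graph transform along the inverse of [theta]: each value is pushed forward from the previous
     index over the previous base point. *)
  pose T (x : 'I_k * Om -> R) (z : 'I_k * Om) :=
    phi (thinv z.2) (x (ord_pred z.1, thinv z.2)).
  have [||||x [mx xball xfix]] := @fixpoint_section R a b k p (fun j => s * w j) mu d Om T mu01 _ pab.
  - by move=> j; rewrite mulr_gt0.
  - move=> x y D D0 xb yb xyD [j om]; rewrite /T /=.
    set z := (_, _); have := ql (thinv om) z.1 _ _ (xb z) (yb z).
    have := xyD z; rewrite /=; set u := x z; set v := y z => uv.
    set e := (_ - _ - _) => he.
    have -> : phi (thinv om) u - phi (thinv om) v = e + al (ord_pred j) * (u - v).
      by rewrite /e; ring.
    apply: (le_trans (ler_normD _ _)); rewrite normrM.
    have h1 : (`|al (ord_pred j)| + eta) * `|u - v| <= (`|al (ord_pred j)| + eta) * (D * (s * w (ord_pred j))).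
      by rewrite ler_wpM2l// addr_ge0// ltW.
    have := hw (ord_pred j); rewrite ord_predK => hwj.
    have h2 : (D * s) * ((`|al (ord_pred j)| + eta) * w (ord_pred j)) <= (D * s) * (mu * w j).
      by rewrite ler_wpM2l// mulr_ge0// ltW.
    by move: h1 h2 he; lra.
  - move=> [j om]; rewrite /T /=.
    have := phip (thinv om) (ord_pred j); rewrite ord_predK => /le_trans; apply.
    rewrite mulrAC -!mulrA ler_wpM2l//; first by case/andP: mu01; lra.
    by apply: ler_wpM2l; [exact: ltW|rewrite hm// mem_enum].
  - move=> x mx xab j; rewrite /T /=.
    apply: (measurableT_comp (f := fun om => phi om (x (ord_pred j, om)))) => //.
    exact: measurable_random_eval mphi _ _.
  exists (fun j om => x (j, om)); split; [exact: mx|by move=> j om; exact: (xball (j, om))|move=> j om].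
  by rewrite /= -[RHS]xfix /T /= ordSK thK.
have [eta [mu [w [eta0 mu01 w0 al0 hw]]]] := expanding_weights al1.
(* The iteration below divides by al_j, so the tolerated displacement is governed by the minimum of
   |al_j| w_j. *)
have [|m m0 hm] := @seq_pos_lower_bound R _ (enum 'I_k) (fun j => `|al j| * w j).
  by move=> j _; rewrite mulr_gt0// normr_gt0.
exists eta, ((1 - mu) * m), w; split => //; first by rewrite mulr_gt0// subr_gt0; case/andP: mu01.
move=> s a b s0 pab d Om theta thinv phi mth mthi thK thiK mphi ql phip.
(* A quasi-Newton step: its fixed points are the invariant sections, and no
   inverse branch of [phi] is needed. *)
pose T (x : 'I_k * Om -> R) (z : 'I_k * Om) :=
  x z - (phi z.2 (x z) - x (ordS z.1, theta z.2)) / al z.1.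
have [||||x [mx xball xfix]] := @fixpoint_section R a b k p (fun j => s * w j) mu d Om T mu01 _ pab.
- by move=> j; rewrite mulr_gt0.
- move=> x y D D0 xb yb xyD [j om]; rewrite /T /=.
  have := ql om j _ _ (xb (j, om)) (yb (j, om)).
  have := xyD (j, om); have := xyD (ordS j, theta om) => /=.
  set u := x (j, om); set v := y (j, om); set u' := x (_, _); set v' := y (_, _) => uv' uv.
  set e := (_ - _ - _) => he.
  (* The linear part cancels: only the quasi-linear error [e] and the difference over the next base
     point survive, and [hw] bounds both together. *)
  have -> : u - (phi om u - u') / al j - (v - (phi om v - v') / al j) =
            ((u' - v') - e) / al j.
    by rewrite /e; field.
  rewrite normrM normfV ler_pdivrMr ?normr_gt0//.
  apply: (le_trans (ler_normB _ _)).
  have h1 : eta * `|u - v| <= eta * (D * (s * w j)) by rewrite ler_wpM2l// ltW.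
  have h2 : (D * s) * (eta * w j + w (ordS j)) <= (D * s) * (mu * `|al j| * w j).
    by rewrite ler_wpM2l// mulr_ge0// ltW.
  by move: h1 h2 he uv'; lra.
- move=> [j om]; rewrite /T /=.
  have -> : p j - (phi om (p j) - p (ordS j)) / al j - p j =
            - ((phi om (p j) - p (ordS j)) / al j) by ring.
  rewrite normrN normrM normfV ler_pdivrMr ?normr_gt0//.
  apply: (le_trans (phip om j)).
  have -> : (1 - mu) * (s * w j) * `|al j| = (1 - mu) * ((`|al j| * w j) * s) by ring.
  rewrite -!mulrA ler_wpM2l//; first by case/andP: mu01; lra.
  by rewrite mulrA; apply: ler_wpM2r; [exact: ltW|rewrite hm// mem_enum].
- move=> x mx xab j; rewrite /T /=.
  apply: measurable_funB => //; apply: measurable_funM; last exact: measurable_cst.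
  apply: measurable_funB; first exact: measurable_random_eval mphi _ _.
  by apply: (measurableT_comp (f := fun om => x (ordS j, om))).
exists (fun j om => x (j, om)); split; [exact: mx|by move=> j om; exact: (xball (j, om))|move=> j om].
have /eqP := xfix (j, om); rewrite /T /= -subr_eq0 addrAC subrr add0r oppr_eq0.
by rewrite mulf_eq0 invr_eq0 (negbTE (al0 j)) orbF subr_eq0 => /eqP.
Qed.

(** The mean value theorem applies on the segment between [x] and [y], which convexity keeps within
    [rho] of [c]. *)
Lemma derivable_quasi_linear (R : realType) (g : R -> R) (c rho al eta : R) :
  (forall x, `|x - c| <= rho -> derivable g x 1) ->
  (forall x, `|x - c| <= rho -> `|derive1 g x - al| <= eta) ->
  quasi_linear_on g c rho al eta.
Proof.
move=> gd gal x y; wlog xy : x y / x <= y => [th xb yb|xb yb].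
  have [|/ltW] := leP x y => xy; first exact: th.
  have -> : g x - g y - al * (x - y) = - (g y - g x - al * (y - x)) by ring.
  by rewrite normrN [`|x - y|]distrC; exact: th.
have mid z : x <= z <= y -> `|z - c| <= rho.
  move: xb yb; rewrite !ler_distl => /andP[? ?] /andP[? ?] /andP[? ?].
  by apply/andP; split; lra.
have [z zxy gz] : exists2 z, z \in `[x, y] & g y - g x = derive1 g z * (y - x).
  apply: MVT_segment => //.
    move=> z; rewrite in_itv /= => /andP[xz zy].
    have gz : derivable g z 1 by apply: gd; apply: mid; rewrite !ltW.
    by apply: DeriveDef => //; rewrite derive1E.
  by apply: derivable_within_continuous => z; rewrite in_itv /= => zxy; exact: gd _ (mid _ zxy).
rewrite in_itv /= in zxy.
have -> : g x - g y - al * (x - y) = (derive1 g z - al) * (x - y).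
  by rewrite -(opprB (g y)) gz; ring.
by rewrite normrM ler_wpM2r// gal// mid.
Qed.

Lemma val_iter_ordS k m (j : 'I_k) : val (iter m (@ordS k) j) = ((j + m) %% k)%N.
Proof.
elim: m => [|m IHm]; first by rewrite /= addn0 modn_small.
by rewrite iterS /= [X in (X.+1 %% k)%N]IHm -addn1 modnDml addn1 addnS.
Qed.

(** * Almost sure properties under a measure-preserving bijection *)

Section MeasurePreserving.
Context (R : realType) (d : measure_display) (Om : measurableType d).
Variable P : probability Om R.

Lemma measurable_preimage (g : Om -> Om) (A : set Om) :
  measurable_fun setT g -> measurable A -> measurable (g @^-1` A).
Proof. by move=> mg mA; rewrite -[_ @^-1` _]setTI; exact: mg. Qed.

Lemma measure_preserving_iter (theta : Om -> Om) n :
  measure_preserving P theta -> measure_preserving P (iter n theta).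
Proof.
move=> [mth Pth]; elim: n => [|n [mn Pn]]; first by split; [exact: measurable_id|].
split; first exact: (measurableT_comp mth mn).
by move=> A mA; rewrite -[RHS]Pth// -[RHS]Pn//; exact: measurable_preimage.
Qed.

Lemma measure_preserving_inv (theta thinv : Om -> Om) :
  measure_preserving P theta -> measurable_fun setT thinv ->
  cancel theta thinv -> measure_preserving P thinv.
Proof.
move=> [mth Pth] mthi thK; split=> // A mA.
rewrite -Pth; last exact: measurable_preimage.
by congr (P _); apply/seteqP; split => w /=; rewrite thK.
Qed.

(** Deleting the preimages of the null set under all iterates of [theta] and of its inverse costs
    only a null set and leaves an exactly invariant set. Exactness matters because [ergodic] speaks
    of sets equal to their preimage, not equal up to null sets. *)
Lemma ae_invariant_core (theta : Om -> Om) (A : Om -> Prop) :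
  invertible_measure_preserving P theta -> {ae P, forall w, A w} ->
  exists G : set Om, [/\ measurable G, {ae P, forall w, G w},
    forall w, G (theta w) <-> G w & forall w, G w -> A w].
Proof.
move=> [mp [thinv [mthi thK thiK]]] [E [mE PE AE]].
have mpi := measure_preserving_inv mp mthi thK.
pose F n := (iter n theta) @^-1` E `|` (iter n thinv) @^-1` E.
have mF n : measurable (F n).
  apply: measurableU; apply: measurable_preimage => //.
    by case: (measure_preserving_iter n mp).
  by case: (measure_preserving_iter n mpi).
have Finv w : (\bigcup_n F n) (theta w) <-> (\bigcup_n F n) w.
  split.
    move=> [n _ [h|]]; first by exists n.+1 => //; left; rewrite /= -iterSr in h *.
    (* The two halves of the union meet at 0: backward index 0 over [theta w] is forward index 1
       over [w]. *)
    case: n => [h|n h]; first by exists 1%N => //; left.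
    by exists n => //; right; move: h; rewrite /preimage /= -iterS iterSr thK.
  move=> [n _ [|h]]; last by exists n.+1 => //; right; rewrite /preimage /= -iterS iterSr thK.
  case: n => [h|n h]; first by exists 1%N => //; right; rewrite /preimage /= thK.
  by exists n => //; left; rewrite /preimage /= -iterSr.
exists (~` \bigcup_n F n); split.
- by apply: measurableC; exact: bigcupT_measurable.
- rewrite /almost_everywhere /=; apply: (negligibleS (A := \bigcup_n F n)).
    by move=> w /= /contrapT.
  apply: negligible_bigcup => n; apply: negligibleU.
    exists (iter n theta @^-1` E); split => //.
      by apply: measurable_preimage => //; case: (measure_preserving_iter n mp).
    by have [_ h] := measure_preserving_iter n mp; exact: etrans (h _ mE) PE.
  exists (iter n thinv @^-1` E); split => //.
    by apply: measurable_preimage => //; case: (measure_preserving_iter n mpi).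
  by have [_ h] := measure_preserving_iter n mpi; exact: etrans (h _ mE) PE.
- by move=> w; split; apply: contra_not => /Finv.
- move=> w Gw; apply: contrapT => nA; apply: Gw; exists 0%N => //; left; exact: AE.
Qed.

End MeasurePreserving.

(** * Consequences of an invariant section *)

Section InvariantSection.
Context (R : realType) (d : measure_display) (Om : measurableType d).
Variables (P : probability Om R) (theta : Om -> Om) (phi : Om -> R -> R).
Variables (k : nat) (x : 'I_k -> Om -> R) (a b d0 d1 : R).
Hypothesis k_gt0 : (0 < k)%N.
Hypothesis mx : forall j, measurable_fun setT (x j).
Hypothesis xab : forall j w, a <= x j w <= b.
Hypothesis xinv : forall j w, phi w (x j w) = x (ordS j) (theta w).
Hypothesis d1_gt0 : 0 < d1.
Hypothesis xclose : forall j w w', `|x j w - x j w'| <= d0.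
Hypothesis xapart : forall i j w w', i != j -> d1 <= `|x i w - x j w'|.

Let j0 : 'I_k := Ordinal k_gt0.

Lemma section_inj i j w : x i w = x j w -> i = j.
Proof.
move=> xij; apply/eqP/negPn/negP => /(xapart w w).
by rewrite xij subrr normr0 leNgt d1_gt0.
Qed.

Lemma rds_section n j w :
  rds theta phi n w (x j w) = x (iter n (@ordS k) j) (iter n theta w).
Proof. by elim: n => //= n ->. Qed.

(** After l steps x_0 has moved to x_l over the shifted base point. For 0 < l < k this differs from
    x_0 there, for every [w], so the event in question is the whole space. *)
Lemma section_random_periodic_point_min :
  random_periodic_point_min P theta phi a b (x j0) k.
Proof.
split.
  split; first by split; [exact: mx|].
  apply: aeW => w; rewrite rds_section; congr (x _ _); apply: val_inj.
  by rewrite val_iter_ordS /= add0n modnn.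
move=> l /andP[l0 lk].
rewrite [X in P X](_ : _ = setT) ?probability_setT ?lte01//.
apply/seteqP; split => // w _ /=; rewrite rds_section.
apply/negP => /eqP/section_inj/(congr1 val).
by rewrite val_iter_ordS /= add0n modn_small// => l00; rewrite l00 in l0.
Qed.

(** The points of [S_ell] are values of one x_l over different base points; this is why [d0] and
    [d1] are bounds over all pairs [w], [w']. *)
Lemma section_delta_k_random_periodic_point delta : d0 < delta < d1 ->
  delta_k_random_periodic_point P theta phi a b (x j0) delta k.
Proof.
move=> /andP[d0d dd1]; split; first by split; [exact: mx|].
have orb w n l (lk : (l < k)%N) : rds theta phi (n * k + l) w (x j0 w) =
    x (Ordinal lk) (iter (n * k + l) theta w).
  rewrite rds_section; congr (x _ _); apply: val_inj.
  by rewrite val_iter_ordS /= add0n modnMDl modn_small.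
apply: aeW => w; split => [l lk|i j ik jk ij].
  apply: le_lt_trans d0d; apply: ge_sup.
    by eexists; exists (rds theta phi (0 * k + l) w (x j0 w)); [exists 0%N|
      exists (rds theta phi (0 * k + l) w (x j0 w)); [exists 0%N|]].
  by move=> _ [_ [m _ <-] [_ [n _ <-] <-]]; rewrite !(orb _ _ _ lk).
apply: (lt_le_trans dd1); apply: lb_le_inf.
  by eexists; exists (rds theta phi (0 * k + i) w (x j0 w)); [exists 0%N|
    exists (rds theta phi (0 * k + j) w (x j0 w)); [exists 0%N|]].
move=> _ [_ [m _ <-] [_ [n _ <-] <-]]; rewrite (orb _ _ _ ik) (orb _ _ _ jk).
by apply: xapart; apply: contra ij => /eqP[->].
Qed.

Definition section_set (w : Om) : set R := range (x ^~ w).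

Lemma section_random_set : random_set a b section_set.
Proof.
split=> [w _ [j _ <-]|U oU]; first by rewrite /= in_itv/=.
rewrite [X in measurable X](_ : _ = \bigcup_j (x j @^-1` U)).
  apply: fin_bigcup_measurable => [|j _]; first exact: finite_finset.
  by rewrite -[_ @^-1` _]setTI; apply: mx => //; exact: open_measurable.
apply/seteqP; split => w.
  by move=> [_ [[j _ <-] Uj]]; exists j.
by move=> [j _ Uj]; exists (x j w); split => //; exists j.
Qed.

Lemma section_random_periodic_orbit :
  random_periodic_orbit P theta phi a b section_set k.
Proof.
split; first exact: section_random_set.
  apply: aeW => w; apply/seteqP; split.
    by move=> _ [_ [j _ <-] <-]; exists (ordS j).
  move=> _ [j _ <-]; exists (x (ord_pred j) w); first by exists (ord_pred j).
  by rewrite xinv ord_predK.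
apply: aeW => w; exists [seq x j w | j <- enum 'I_k]; split.
- by rewrite map_inj_uniq ?enum_uniq// => i j; exact: section_inj.
- by rewrite size_map size_enum_ord.
apply/seteqP; split => y /=.
  by move=> [j _ <-]; apply/mapP; exists j => //; rewrite mem_enum.
by move=> /mapP[j _ ->]; exists j.
Qed.

(** The events B_j that x_j lies in [Q] are carried to one another by [theta], so they have equal
    probability, and B_0 is invariant under the k-th iterate. Hence all have probability 0, which
    nonemptiness of [Q] excludes, or all have probability 1. *)
Lemma section_random_periodic_orbit_min (U : 'I_k -> set R) :
  (forall j, open (U j)) -> (forall j w, U j (x j w)) ->
  (forall i j w, U j (x i w) -> i = j) ->
  invertible_measure_preserving P theta -> ergodic P (iter k theta) ->
  random_periodic_orbit_min P theta phi a b section_set k.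
Proof.
move=> oU Ux UxE imp erg; split; first exact: section_random_periodic_orbit.
move=> Q [Qab mQ] Qinv QS Q0.
have [G [mG aeG Ginv GA]] := ae_invariant_core imp (filterI (filterI Qinv QS) Q0).
pose B j : set Om := G `&` [set w | Q w (x j w)].
(* Over the core [Q] lies inside the orbit and [U j] isolates x_j, so containing x_j means meeting
   the open set [U j], an event covered by Effros measurability. *)
have mB j : measurable (B j).
  rewrite (_ : B j = G `&` [set w | Q w `&` U j !=set0]).
    by apply: measurableI => //; exact: mQ.
  apply/seteqP; split => w [Gw Qw]; split => //=.
    by exists (x j w).
  have [[_ QSw] _] := GA _ Gw.
  have [y [Qy Uy]] := Qw; have [i _ xi] := QSw _ Qy.
  by move: Qy Uy; rewrite -xi => Qi /UxE <-.
have Bth j w : B (ordS j) (theta w) <-> B j w.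
  split=> -[Gw Qw].
    (* Invariance gives a preimage in [Q w]; it is some x_i, and injectivity of the section forces i
       = j. *)
    move/Ginv in Gw; have [[Qi QSw] _] := GA _ Gw; split => //.
    move: Qw => /=; rewrite -Qi => -[y Qy]; have [i _ xi] := QSw _ Qy.
    move: Qy; rewrite -xi => Qy; rewrite xinv => /section_inj/(congr1 (@ord_pred k)).
    by rewrite !ordSK => <-.
  have [[Qi _] _] := GA _ Gw; split; first exact/Ginv.
  by rewrite /= -Qi -xinv; exists (x j w).
have Bthn n j w : B (iter n (@ordS k) j) (iter n theta w) <-> B j w.
  by elim: n => //= n IHn; rewrite Bth.
have PB j : P (B j) = P (B j0).
  have [_ Pn] := measure_preserving_iter j imp.1.
  rewrite -(Pn (B j))//; congr (P _); apply/seteqP.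
  have jE : iter j (@ordS k) j0 = j.
    by apply: val_inj; rewrite val_iter_ordS add0n modn_small.
  by split => w; [move: (Bthn j j0 w).1|move: (Bthn j j0 w).2]; rewrite jE; apply.
have Binv : iter k theta @^-1` B j0 = B j0.
  have jE : iter k (@ordS k) j0 = j0.
    by apply: val_inj; rewrite val_iter_ordS add0n modnn.
  apply/seteqP.
  by split => w; [move: (Bthn k j0 w).1|move: (Bthn k j0 w).2]; rewrite jE; apply.
case: (erg _ (mB j0) Binv) => PB0.
  have aeN : {ae P, forall w, forall j, ~ B j w}.
    apply: filter_forall => j; exists (B j); split; rewrite ?PB//.
    by move=> w /= /contrapT.
  have [E [mE PE hE]] : {ae P, forall w : Om, False}.
    apply: filterS2 aeN aeG => w nB Gw.
    have [[_ QSw] [y Qy]] := GA _ Gw; have [j _ xj] := QSw _ Qy.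
    by apply: (nB j); split => //=; rewrite xj.
  have ET : E = setT by apply/seteqP; split => // w _; exact: hE.
  move: PE; rewrite ET probability_setT => /eqP; by rewrite onee_eq0.
have aeB : {ae P, forall w, forall j, B j w}.
  apply: filter_forall => j; exists (~` B j); split => //; first exact: measurableC.
  by rewrite probability_setC// PB PB0 subee.
apply: filterS2 aeB aeG => w Bw Gw; apply/seteqP; split; first exact: (GA _ Gw).1.2.
by move=> _ [j _ <-]; exact: (Bw j).2.
Qed.

End InvariantSection.

(** * Periodic orbits and derivatives of iterates *)

Lemma iter_periodic_mul (A : Type) (f : A -> A) k m p :
  iter k f p = p -> iter (m * k) f p = p.
Proof. by move=> fp; elim: m => //= m IHm; rewrite mulSn iterD IHm. Qed.

Lemma periodic_pt_min_dvdn (R : realType) (f : R -> R) k m p :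
  periodic_pt_min f k p -> iter m f p = p -> (k %| m)%N.
Proof.
move=> [k0 fk fmin] fm; rewrite /dvdn; apply/negPn/negP; rewrite -lt0n => r0.
have := fmin (m %% k)%N; rewrite r0 ltn_pmod// => /(_ isT)/negP; apply.
apply/eqP; rewrite -[RHS]fm {2}(divn_eq m k) addnC iterD.
by rewrite iter_periodic_mul.
Qed.

(** A common point makes each minimal period divide the other. Since [p] is a function of the
    period, the base points then agree too, and two indices below k giving the same point
    coincide. *)
Lemma periodic_orbits_eq (R : realType) (f : R -> R) (p : nat -> R) k j k' j' :
  periodic_pt_min f k (p k) -> periodic_pt_min f k' (p k') ->
  (j < k)%N -> (j' < k')%N ->
  iter j f (p k) = iter j' f (p k') -> (k, j) = (k', j').
Proof.
have comm m n y : iter m f (iter n f y) = iter n f (iter m f y).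
  by rewrite -!iterD addnC.
have dvd k1 j1 k2 j2 : periodic_pt_min f k1 (p k1) -> periodic_pt_min f k2 (p k2) ->
    (j1 < k1)%N -> iter j1 f (p k1) = iter j2 f (p k2) -> (k1 %| k2)%N.
  move=> P1 [_ fk2 _] jk1 E; apply: (periodic_pt_min_dvdn P1).
  have [_ fk1 _] := P1.
  have pE : iter (k1 - j1) f (iter j1 f (p k1)) = p k1 by rewrite -iterD subnK// ltnW.
  have zE : iter k2 f (iter j1 f (p k1)) = iter j1 f (p k1) by rewrite E comm fk2.
  by rewrite -{1}pE comm zE.
move=> Pk Pk' jk jk' E.
have kk' : k = k'.
  by apply/eqP; rewrite eqn_dvd (dvd _ _ _ _ Pk Pk' jk E) (dvd _ _ _ _ Pk' Pk jk' (esym E)).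
subst k'; congr pair; clear Pk' dvd.
have [_ fk _] := Pk.
have {}dvd i i' : (i < k)%N -> (i' < k)%N -> iter i f (p k) = iter i' f (p k) ->
    (k %| k - i + i')%N.
  move=> ik ik' Ei; apply: (periodic_pt_min_dvdn Pk).
  by rewrite iterD -Ei -iterD subnK// ltnW.
wlog jj' : j j' jk jk' E / (j <= j')%N => [th|].
  by have [|/ltnW] := leqP j j' => h; [exact: th|apply/esym; exact: th].
(* Here k divides j' - j, which lies in [0, k), so it vanishes. *)
have := dvd _ _ jk jk' E; rewrite addnBAC ?(ltnW jk)// -addnBA// dvdn_addr//.
move=> /dvdn_leq h; apply/eqP; rewrite eqn_leq jj' /= -subn_eq0.
by rewrite -leqn0 leqNgt; apply/negP => /h; lia.
Qed.

Lemma is_derive_iter (R : realType) (f : R -> R) (x : R) n :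
  (forall j, (j < n)%N -> derivable f (iter j f x) 1) ->
  is_derive x 1 (iter n f) (\prod_(j < n) derive1 f (iter j f x)).
Proof.
elim: n => [|n IHn] df; first by rewrite big_ord0; exact: is_derive_id.
rewrite big_ord_recr /= mulrC.
apply: (@is_derive1_comp _ f (iter n f)).
  by rewrite derive1E; apply: derivableP; exact: df.
by apply: IHn => j jn; apply: df; exact: ltnW.
Qed.

(** * Persistence of one hyperbolic orbit *)

(** The first breakpoint above [y] (or [b]) closes the piece whose interior contains [y]. *)
Lemma sorted_breakpoints_between (R : realType) (a b y : R) (s : seq R)
    (Q : R -> R -> Prop) :
  a < y < b -> y \notin s ->
  (forall i, (i < (size s).+1)%N -> Q (nth 0 (a :: s) i) (nth 0 (rcons s b) i)) ->
  exists u v, Q u v /\ u < y < v.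
Proof.
elim: s a => [|t s IHs] a /andP[ay yb].
  by move=> _ /(_ 0%N isT) /= Qab; exists a, b; rewrite ay.
rewrite inE negb_or => /andP[yt ys] HQ.
have [yt'|ty|yt'] := ltgtP y t.
- by exists a, t; rewrite ay; split => //; exact: (HQ 0%N).
- by apply: (IHs t); rewrite ?ty// => i; exact: (HQ i.+1).
- by rewrite yt' eqxx in yt.
Qed.

(** As [derive1] is total, the bound on derivatives in [R1eps] does not by itself give
    differentiability; it comes from the breakpoints avoiding [N]. *)
Lemma piecewise_C1_derivable (R : realType) (a b : R) (N : set R) (g : R -> R) y :
  piecewise_C1 a b N g -> N y -> a < y < b -> derivable g y 1.
Proof.
move=> [s [_ sN HC]] Ny yab.
have ys : y \notin s by apply/negP => /sN.
have [u [v [[_ _ [dg [_ hd]]] yuv]]] := sorted_breakpoints_between yab ys HC.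
by have [] := hd _ yuv.
Qed.

(** The radii and [eps] are fixed before [Om], [theta] and [phi] are quantified, as the theorem
    requires. The cap [D] on the radii serves to keep different orbits apart. *)
Definition persistence_margin (R : realType) (a b : R) (f : R -> R) k p (D : R)
    (rho : nat -> R) (eps : R) : Prop :=
  [/\ 0 < eps, forall j, (j < k)%N -> 0 < rho j <= D,
      forall j y, (j < k)%N -> `|y - iter j f p| <= rho j -> derivable f y 1 &
  forall d (Om : measurableType d) (theta thinv : Om -> Om) (phi : Om -> R -> R),
    measurable_fun setT theta -> measurable_fun setT thinv ->
    cancel theta thinv -> cancel thinv theta ->
    measurable_fun (setT `*` `[a, b]) (fun z : Om * R => phi z.1 z.2) ->
    (forall j, (j < k)%N -> a <= iter j f p - rho j /\ iter j f p + rho j <= b) ->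
    (forall w j y, (j < k)%N -> `|y - iter j f p| <= rho j ->
       derivable (phi w) y 1 /\
       `|phi w y - f y| + `|derive1 (phi w) y - derive1 f y| <= eps) ->
    has_invariant_section (fun j : 'I_k => iter j f p) (fun j => rho j) theta phi].

(** The radii are s w_j for a small s. Half of [eta] pays for the oscillation of f' near the orbit,
    half for the perturbation of the derivative, and c s for the displacement of the centres; hence
    [eps] = min (eta / 2) (c s). *)
Lemma hyperbolic_persistence_margin (R : realType) (a b : R) (f : R -> R) k p (D : R) :
  periodic_pt_min f k p -> hyperbolic_int_orbit a b f k p -> 0 < D ->
  exists (rho : nat -> R) (eps : R), persistence_margin a b f k p D rho eps.
Proof.
move=> [k0 fk _] [_ [e [e0 he]] hyp] D0.
case: k k0 fk he hyp => // k _ fk he hyp.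
pose al (j : 'I_k.+1) : R := derive1 f (iter j f p).
have fd j : (j < k.+1)%N -> derivable f (iter j f p) 1.
  by move=> jk; apply: (he j jk _ _).1; rewrite subrr normr0.
have al1 : `|\prod_j al j| != 1.
  have := hyp 0%N isT; rewrite derive1E.
  by have /@derive_val -> := is_derive_iter fd.
have [eta [c [w [eta0 c0 w0 Hsec]]]] := hyperbolic_section (fun j : 'I_k.+1 => iter j f p) al1.
have eta2 : 0 < eta / 2 by rewrite divr_gt0.
have /choice[r hr] (j : 'I_k.+1) : exists r, 0 < r /\
    forall y, `|y - iter j f p| < r -> `|derive1 f y - al j| <= eta / 2.
  have [_ fc] : derivable f (iter j f p) 1 /\ {for iter j f p, continuous (derive1 f)}.
    by apply: (he j) => //; rewrite subrr normr0.
  have /nbhs_ballP[r /= r0 hr] :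
      \forall y \near iter j f p, `|derive1 f (iter j f p) - derive1 f y| <= eta / 2.
    exact: (cvgr_dist_le (derive1 f) _ fc).
  exists r; split => // y yr; rewrite distrC; apply: hr.
  by rewrite /ball /= distrC.
(* Halving [e] and [r j] makes the resulting bounds on s w_j strict. *)
pose F j := Num.min D (Num.min (e / 2) (r j / 2)) / w j.
have [j _|s s0 hs] := @seq_pos_lower_bound R _ (enum 'I_k.+1) F.
  by rewrite divr_gt0// !lt_min D0 !divr_gt0//; case: (hr j).
have {}hs j : [/\ s * w j <= D, s * w j < e & s * w j < r j].
  have := hs j; rewrite mem_enum => /(_ isT); rewrite /F ler_pdivlMr// !le_min.
  by move=> /and3P[h1 h2 h3]; have [rj0 _] := hr j; split; lra.
exists (fun j => s * w (inord j)), (Num.min (eta / 2) (c * s)); split.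
- by rewrite lt_min eta2 mulr_gt0.
- by move=> j _; rewrite mulr_gt0//=; case: (hs (inord j)).
- move=> j y jk yj; apply: (he j jk _ _).1; apply: le_lt_trans yj _.
  by case: (hs (inord j)).
move=> d Om theta thinv phi mth mthi thK thiK mphi pab phic.
have -> : (fun j : 'I_k.+1 => s * w (inord j)) = (fun j => s * w j).
  by apply/funext => j; rewrite inord_val.
apply: (Hsec s a b s0 _ d Om theta thinv phi) => //.
- by move=> j; have := pab j (ltn_ord j); rewrite inord_val.
- move=> om j; have phij y : `|y - iter j f p| <= s * w j -> derivable (phi om) y 1 /\
    `|phi om y - f y| + `|derive1 (phi om) y - derive1 f y| <= Num.min (eta / 2) (c * s).
    by move=> yj; apply: (phic om j) => //; rewrite inord_val.
  apply: derivable_quasi_linear => y yj; have [h1 h2] := phij y yj => //.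
  have h3 : `|derive1 f y - al j| <= eta / 2.
    by apply: (hr j).2; apply: (le_lt_trans yj); case: (hs j).
  move: h2; rewrite le_min => /andP[h2 _].
  have := ler_normD (derive1 (phi om) y - derive1 f y) (derive1 f y - al j).
  rewrite subrKA => /le_trans; apply; have := normr_ge0 (phi om y - f y); move: h2 h3; lra.
- move=> om j; have := (phic om j (iter j f p) (ltn_ord j)).
  rewrite inord_val subrr normr0 => -[|_]; first by rewrite mulr_ge0// ltW.
  rewrite le_min => /andP[_].
  (* At the last index [ordS] returns to 0 and periodicity of [p] closes the cycle. *)
  have -> : iter (ordS j) f p = f (iter j f p).
    rewrite /=; case: (ltnP j.+1 k.+1) => jk; first by rewrite modn_small.
    have jk1 : j.+1 = k.+1 by apply/eqP; rewrite eqn_leq jk ltn_ord.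
    by rewrite jk1 modnn -iterS jk1 fk.
  apply: le_trans; rewrite lerDl//.
Qed.

(** * Separation of the orbits and the main theorem *)

Lemma orbit_separation (R : realType) (a b : R) (T : seq nat) (f : R -> R)
    (p : nat -> R) :
  (forall k, k \in T -> periodic_pt_min f k (p k)) ->
  (forall k j, k \in T -> (j < k)%N -> a < iter j f (p k) < b) ->
  exists D : R, [/\ 0 < D,
    forall k j, k \in T -> (j < k)%N ->
      D <= iter j f (p k) - a /\ D <= b - iter j f (p k) &
    forall k j k' j', k \in T -> k' \in T -> (j < k)%N -> (j' < k')%N ->
      (k, j) != (k', j') -> D <= `|iter j f (p k) - iter j' f (p k')|].
Proof.
move=> pP pab.
pose L := [seq (k, j) | k <- T, j <- iota 0 k].
have LP u : u \in L -> u.1 \in T /\ (u.2 < u.1)%N.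
  by move=> /allpairsPdep[k [j [kT]]]; rewrite mem_iota add0n => /andP[_ jk] ->.
have inL k j : k \in T -> (j < k)%N -> (k, j) \in L.
  by move=> kT jk; apply/allpairsPdep; exists k, j; rewrite mem_iota.
pose pt (u : nat * nat) := iter u.2 f (p u.1).
have [u /LP[uT uj]|D1 D10 hD1] :=
    @seq_pos_lower_bound R _ L (fun u => Num.min (pt u - a) (b - pt u)).
  by have /andP[h1 h2] := pab _ _ uT uj; rewrite lt_min !subr_gt0 h1 h2.
(* Diagonal pairs get the value 1, so that the minimum over all pairs is positive. *)
have [[u v]|D2 D20 hD2] := @seq_pos_lower_bound R _ [seq (u, v) | u <- L, v <- L]
    (fun uv => if uv.1 == uv.2 then 1 else `|pt uv.1 - pt uv.2|).
  move=> /allpairsP[[u' v'] /= [/LP[uT uj] /LP[vT vj] [-> ->]]].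
  case: eqP => // uv; rewrite normr_gt0 subr_eq0; apply/eqP => E; apply: uv.
  case: u' v' uT uj vT vj E => [k j] [k' j'] /= uT uj vT vj E.
  exact: (periodic_orbits_eq (pP _ uT) (pP _ vT) uj vj E).
exists (Num.min D1 D2); split; first by rewrite lt_min D10.
  move=> k j kT jk; have := hD1 _ (inL _ _ kT jk); rewrite le_min => /andP[h1 h2].
  by rewrite !ge_min h1 h2.
move=> k j k' j' kT k'T jk jk' neq.
have := hD2 ((k, j), (k', j')); rewrite (negbTE neq) => h.
by rewrite ge_min h ?orbT//; apply/allpairsP; exists ((k, j), (k', j')); split => //=; exact: inL.
Qed.

Theorem mainTheorem2 (R : realType) (a b : R) (T : seq nat) (n : nat) (f : R -> R) :
  a < b ->
  finite_shark_tail T n ->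
  (forall x, a <= x <= b -> a <= f x <= b) ->
  {within `[a, b], continuous f} ->
  H_T a b T f ->
  (forall k, k \in T -> exists p, a <= p <= b /\ periodic_pt_min f k p) ->
  exists (p : nat -> R) (l r : nat -> nat -> R) (eps delta : R),
    (forall k, k \in T ->
        periodic_pt_min f k (p k) /\ (forall j, (j < k)%N -> a < iter j f (p k) < b)) /\
    (forall k j, k \in T -> (j < k)%N ->
        a < l k j /\ l k j < iter j f (p k) < r k j /\ r k j < b) /\
    (forall k j k' j', k \in T -> k' \in T -> (j < k)%N -> (j' < k')%N ->
        (k, j) != (k', j') -> `[l k j, r k j] `&` `[l k' j', r k' j'] = set0) /\
    0 < eps /\ 0 < delta /\
    (forall x, Nunion T l r x -> derivable f x 1) /\
    (forall (d : measure_display) (Om : measurableType d) (P : probability Om R)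
            (theta : Om -> Om),
       invertible_measure_preserving P theta -> ergodic P theta ->
       forall phi : Om -> R -> R, R1eps a b (Nunion T l r) f eps phi ->
         (forall k, k \in T ->
            exists x : Om -> R, random_periodic_point_min P theta phi a b x k) /\
         ((forall k, (0 < k)%N -> ergodic P (iter k theta)) ->
            forall k, k \in T ->
              exists S : Om -> set R, random_periodic_orbit_min P theta phi a b S k) /\
         (forall k, k \in T ->
            exists x : Om -> R, delta_k_random_periodic_point P theta phi a b x delta k)).
Proof.
move=> _ _ _ _ hyp per.
have /choice[p hp] k : exists p, k \in T -> a <= p <= b /\ periodic_pt_min f k p.
  case: (boolP (k \in T)) => kT; last by exists 0.
  by have [p hp] := per k kT; exists p.
have pP k kT := (hp k kT).2.
have pH k (kT : k \in T) : hyperbolic_int_orbit a b f k (p k).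
  exact: hyp k kT _ (hp k kT).1 (pP k kT).
have pI k j : k \in T -> (j < k)%N -> a < iter j f (p k) < b.
  by move=> kT; case: (pH k kT) => h _ _; exact: h.
have [D [D0 Dab Dsep]] := orbit_separation pP pI.
(* Radii of at most D/8 give each x_j a spread of at most D/4 and keep distinct ones at least D/2
   apart; [delta] = D/3 lies between. *)
have D8 : 0 < D / 8 by rewrite divr_gt0.
have /choice[re hre] k : exists re : (nat -> R) * R,
    k \in T -> persistence_margin a b f k (p k) (D / 8) re.1 re.2.
  case: (boolP (k \in T)) => kT; last by exists (fun=> 0, 0).
  have [rho [ep h]] := hyperbolic_persistence_margin (pP k kT) (pH k kT) D8.
  by exists (rho, ep).
pose rho k := (re k).1.
have rhoP k j : k \in T -> (j < k)%N -> 0 < rho k j <= D / 8.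
  by move=> kT jk; have [_ h _ _] := hre k kT; exact: h.
have [k kT|eps eps0 heps] := @seq_pos_lower_bound R _ T (fun k => (re k).2).
  by case: (hre k kT).
pose l k j := iter j f (p k) - rho k j; pose r k j := iter j f (p k) + rho k j.
have lrP k j y : (l k j <= y <= r k j) = (`|y - iter j f (p k)| <= rho k j).
  by rewrite ler_distl.
have lrab k j : k \in T -> (j < k)%N -> a < l k j /\ r k j < b.
  move=> kT jk; have [h1 h2] := Dab k j kT jk; have /andP[h3 h4] := rhoP k j kT jk.
  by rewrite /l /r; split; lra.
exists p, l, r, eps, (D / 3); split; first by move=> k kT; split=> [|j jk]; [exact: pP|exact: pI].
split.
  move=> k j kT jk; have [h1 h2] := lrab k j kT jk; have /andP[h3 _] := rhoP k j kT jk.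
  by split => //; split => //; rewrite /l /r; apply/andP; split; lra.
split.
  move=> k j k' j' kT k'T jk jk' neq; apply/seteqP; split => // y [] /=.
  rewrite !in_itv /= !lrP => h1 h2.
  have /andP[_ h3] := rhoP k j kT jk; have /andP[_ h4] := rhoP k' j' k'T jk'.
  have := Dsep _ _ _ _ kT k'T jk jk' neq.
  have := ler_normB (y - iter j' f (p k')) (y - iter j f (p k)).
  rewrite (_ : _ - _ - (_ - _) = iter j f (p k) - iter j' f (p k')); last by ring.
  by move: h1 h2 h3 h4; lra.
split => //; split; first by rewrite divr_gt0.
have NP k j y : k \in T -> (j < k)%N -> `|y - iter j f (p k)| <= rho k j ->
    Nunion T l r y by move=> kT jk yj; exists k, j; split => //; rewrite lrP.
split.
  move=> y [k [j [kT jk]]]; rewrite lrP => yj.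
  by have [_ _ h _] := hre k kT; exact: h yj.
move=> d Om P theta imp _ phi [mphi _ phiC [et [et_lt phiN]] _].
have [[mth _] [thinv [mthi thK thiK]]] := imp.
have sec k : k \in T ->
    has_invariant_section (fun j : 'I_k => iter j f (p k)) (fun j => rho k j) theta phi.
  move=> kT; have [_ _ _ h] := hre k kT; apply: (h _ _ theta thinv) => //.
    by move=> j jk; have [h1 h2] := lrab k j kT jk; split; apply: ltW.
  move=> w j y jk yj; have Ny := NP k j y kT jk yj.
  split.
    apply: (piecewise_C1_derivable (phiC w).2 Ny).
    have [h1 h2] := lrab k j kT jk.
    by move: yj; rewrite -lrP => /andP[h3 h4]; rewrite (lt_le_trans h1 h3) (le_lt_trans h4 h2).
  apply: (le_trans (phiN w y Ny)); apply: (le_trans (ltW et_lt)); exact: heps.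
have secP k (kT : k \in T) (k0 : (0 < k)%N) : exists x : 'I_k -> Om -> R,
    [/\ random_periodic_point_min P theta phi a b (x (Ordinal k0)) k,
        delta_k_random_periodic_point P theta phi a b (x (Ordinal k0)) (D / 3) k &
        ergodic P (iter k theta) ->
          random_periodic_orbit_min P theta phi a b (section_set x) k].
  have [x [mx xrho xinv]] := sec k kT.
  have xD j w : `|x j w - iter j f (p k)| <= D / 8.
    by have /andP[_ h] := rhoP k j kT (ltn_ord j); exact: le_trans (xrho j w) h.
  have xab j w : a <= x j w <= b.
    have [h1 h2] := lrab k j kT (ltn_ord j).
    have := xrho j w; rewrite -lrP => /andP[h3 h4].
    by rewrite (le_trans (ltW h1) h3) (le_trans h4 (ltW h2)).
  have sep (i j : 'I_k) : i != j -> D <= `|iter i f (p k) - iter j f (p k)|.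
    by move=> ij; apply: Dsep => //; rewrite xpair_eqE eqxx.
  have xclose j w w' : `|x j w - x j w'| <= D / 4.
    have := ler_normB (x j w - iter j f (p k)) (x j w' - iter j f (p k)).
    rewrite (_ : _ - _ - (_ - _) = x j w - x j w'); last by ring.
    by have := xD j w; have := xD j w'; lra.
  have xfar (i j : 'I_k) w : i != j -> D - D / 8 <= `|x i w - iter j f (p k)|.
    move=> ij; have := ler_normB (x i w - iter j f (p k)) (x i w - iter i f (p k)).
    rewrite (_ : _ - _ - (_ - _) = iter i f (p k) - iter j f (p k)); last by ring.
    by have := sep _ _ ij; have := xD i w; lra.
  have xapart i j w w' : i != j -> D / 2 <= `|x i w - x j w'|.
    move=> ij; have := ler_normD (x i w - x j w') (x j w' - iter j f (p k)).
    rewrite subrKA; have := xfar _ _ w ij; have := xD j w'; move: D0; lra.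
  have D2 : 0 < D / 2 by rewrite divr_gt0.
  exists x; split.
  - exact: (section_random_periodic_point_min P k0 mx xab xinv D2 xapart).
  - apply: (section_delta_k_random_periodic_point P k0 mx xab xinv xclose xapart).
    by apply/andP; split; move: D0; lra.
  - move=> erg.
    (* The ball of radius D/2 contains x_j, within D/8 of its centre, and excludes every other x_i,
       at least 7D/8 away. *)
    apply: (section_random_periodic_orbit_min (P := P) k0 mx xab xinv D2 xapart
      (U := fun j => ball (iter j f (p k)) (D / 2))) => //.
    + by move=> j; exact: ball_open.
    + by move=> j w; rewrite /ball /= distrC; have := xD j w; move: D0; lra.
    + move=> i j w; rewrite /ball /= distrC => h; apply/eqP/negPn/negP => /(xfar _ _ w).
      by move: h D0; lra.
have T0 k : k \in T -> (0 < k)%N by move=> /pP[].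
split; first by move=> k kT; have [x [h _ _]] := secP k kT (T0 k kT); eexists; exact: h.
split; last by move=> k kT; have [x [_ h _]] := secP k kT (T0 k kT); eexists; exact: h.
move=> erg k kT; have [x [_ _ h]] := secP k kT (T0 k kT).
by exists (section_set x); apply: h; apply: erg; exact: T0.
Qed.
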